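(* In the translation invariant setting of the context, let $\{\Phi'_\Lambda\}_\Lambda$ be low-lying states, i.e. normalized states $\Phi'_\Lambda\in\mathcal H_\Lambda$, each orthogonal to the ground state $\Phi^{(0)}_\Lambda$ of $H_\Lambda$, with $$\lim_{\Lambda\uparrow\mathbf Z^d}\frac1N\left((\Phi'_\Lambda,H_\Lambda\Phi'_\Lambda)-E^{(0)}_\Lambda\right)=0,$$ and assume that each $\Phi'_\Lambda$ defines translation invariant expectation values, i.e. $(\Phi'_\Lambda,A\,\Phi'_\Lambda)=(\Phi'_\Lambda,\tau_x(A)\,\Phi'_\Lambda)$ for any $x\in\Lambda$ and any local operator $A$. Then the infinite volume state $$\omega'(\cdots):=\lim_{\Lambda\uparrow\mathbf Z^d}(\Phi'_\Lambda,(\cdots)\,\Phi'_\Lambda),$$ defined by taking a suitable subsequence of lattices so that the limit exists for every local operator, is a ground state, i.e. $\omega'(h_x)=\epsilon_0$ for any $x\in\mathbf Z^d$.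
   Context: Each finite lattice $\Lambda$ is a $d$-dimensional hypercubic lattice with $N$ sites and periodic boundary conditions, and one considers a sequence of such lattices tending to $\mathbf Z^d$. To each site $x$ is associated a copy $\mathcal H_x$ of a fixed finite-dimensional Hilbert space, and $\mathcal H_\Lambda=\bigotimes_{x\in\Lambda}\mathcal H_x$. A local operator is an operator acting nontrivially only on $\bigotimes_{x\in\mathcal S}\mathcal H_x$ for some finite set $\mathcal S$ of sites. $\tau_x$ denotes translation of operators by the lattice vector $x$ (respecting the periodic boundary conditions on $\Lambda$). The Hamiltonian is $H_\Lambda=\sum_{x\in\Lambda}h_x$ with $h_x=\tau_x(h_o)$, where $h_o$ is a fixed self-adjoint local operator independent of $\Lambda$. $\Phi^{(0)}_\Lambda$ is the ground state of $H_\Lambda$ and $E^{(0)}_\Lambda$ its ground state energy (lowest eigenvalue). An infinite volume state is a linear functional on local operators obtained as a pointwise limit of finite volume states (a subsequence making the limit exist for all local operators can always be chosen). The ground state energy density is $$\epsilon_0:=\lim_{\Lambda\uparrow\mathbf Z^d}\ \inf_{\Phi_\Lambda\in\mathcal H_\Lambda,\ \|\Phi_\Lambda\|=1}\frac1N(\Phi_\Lambda,H_\Lambda\Phi_\Lambda)$$ (the limit always exists). An infinite volume state $\omega$ is called a ground state if $\omega(h_x)=\epsilon_0$ for every $x\in\mathbf Z^d$. *)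

(* Defs.v *)
From HB Require Import structures.
From mathcomp Require Import all_boot all_order all_algebra.
From mathcomp Require Import complex.
From mathcomp Require Import all_classical all_reals all_analysis.

Set Implicit Arguments.
Unset Strict Implicit.
Unset Printing Implicit Defensive.

Import Order.TTheory GRing.Theory Num.Theory numFieldNormedType.Exports.

Local Open Scope classical_set_scope.
Local Open Scope ring_scope.
Local Open Scope complex_scope.
Local Open Scope sesquilinear_scope.

(** R[i], sealed at [numClosedFieldType] so that it carries the norm topology. *)
Definition Cplx (R : realType) : numClosedFieldType := R[i].

Definition Zd (d : nat) := 'rV[int]_d.

(** The periodic cube (Z / (n+1) Z)^d: its side length is n.+1, so that it is
    never empty. *)
Definition torus (d n : nat) := 'rV['I_n.+1]_d.

Definition to_torus (d n : nat) (z : Zd d) : torus d n :=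
  \row_i inZp `|(z ord0 i %% n.+1%:Z)%Z|%N.

(** Classical configurations label the product basis of the tensor product,
    over a finite set I of sites, of copies of C^q.  Operators and vectors are
    written in that basis, indexed through [enum_val] and [enum_rank]. *)
Definition config (I : finType) (q : nat) := {ffun I -> 'I_q}.

Definition operator (R : realType) (q : nat) (I : finType) :=
  'M[Cplx R]_#|config I q|.

Definition hvector (R : realType) (q : nat) (I : finType) :=
  'cV[Cplx R]_#|config I q|.

Section Hilbert.
Variables (R : realType) (m : nat).

(** Antilinear in the first argument. *)
Definition inner (u v : 'cV[Cplx R]_m) : Cplx R := (u ^t* *m v) 0 0.

Definition normalized (u : 'cV[Cplx R]_m) : Prop := inner u u = 1.

Definition expectation (u : 'cV[Cplx R]_m) (A : 'M[Cplx R]_m) : Cplx R :=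
  inner u (A *m u).

(** Only used for self-adjoint [H], where the expectation is real. *)
Definition energy (H : 'M[Cplx R]_m) (u : 'cV[Cplx R]_m) : R :=
  complex.Re (expectation u H).

(** [<=] on R[i] entails equality of imaginary parts, so this also says that
    the spectrum is real, as it is for self-adjoint [H]. *)
Definition lowest_eigenvalue (H : 'M[Cplx R]_m) (E : R) : Prop :=
  eigenvalue H (E%:C : Cplx R) /\
  forall a : Cplx R, eigenvalue H a -> (E%:C : Cplx R) <= a.

Definition ground_state (H : 'M[Cplx R]_m) (E : R) (u : 'cV[Cplx R]_m) : Prop :=
  [/\ lowest_eigenvalue H E, normalized u & H *m u = (E%:C : Cplx R) *: u].

End Hilbert.

(** A local operator on Z^d: a finite set of sites, given by an injective
    enumeration, and an operator on the tensor product over these sites. *)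
Record local_op (R : realType) (d q : nat) := LocalOp {
  lop_size : nat;
  lop_site : 'I_lop_size -> Zd d;
  lop_inj : injective lop_site;
  lop_mx : operator R q 'I_lop_size }.

Arguments lop_site {R d q} l i.

Section Lattice.
Variables (R : realType) (d q : nat).
Local Notation local_op := (local_op R d q).

Definition self_adjoint (A : local_op) : Prop := lop_mx A \is hermsymmx.

Lemma translate_inj (z : Zd d) (A : local_op) :
  injective (fun i => lop_site A i + z).
Proof. by move=> i j /addIr; apply: lop_inj. Qed.

(** Translation on Z^d. *)
Definition translate (z : Zd d) (A : local_op) : local_op :=
  LocalOp (@translate_inj z A) (lop_mx A).

Definition torus_site (n : nat) (A : local_op) (i : 'I_(lop_size A)) :
  torus d n := to_torus n (lop_site A i).
Arguments torus_site n A i : clear implicits.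

Definition fits (n : nat) (A : local_op) : Prop := injective (torus_site n A).

Definition restrict (n : nat) (A : local_op) (s : config (torus d n) q) :
  config 'I_(lop_size A) q := [ffun i => s (torus_site n A i)].

(** The copy of A on the torus, acting as the identity off its support.  It is
    meaningful when [fits n A], which holds for all large n. *)
Definition embed (n : nat) (A : local_op) : operator R q (torus d n) :=
  \matrix_(i, j)
    let s : config (torus d n) q := enum_val i in
    let t : config (torus d n) q := enum_val j in
    if [forall y, (y \notin codom (torus_site n A)) ==> (s y == t y)]
    then lop_mx A (enum_rank (restrict A s)) (enum_rank (restrict A t))
    else 0.

Definition shift (n : nat) (x : torus d n) (s : config (torus d n) q) :
  config (torus d n) q := [ffun y => s (y + x)].

(** Translation on the torus: it carries an operator acting at the site y to the
    same operator acting at y + x. *)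
Definition tau (n : nat) (x : torus d n) (A : operator R q (torus d n)) :
  operator R q (torus d n) :=
  \matrix_(i, j) A (enum_rank (shift x (enum_val i)))
                   (enum_rank (shift x (enum_val j))).

Definition hamiltonian (n : nat) (h : local_op) : operator R q (torus d n) :=
  \sum_(x : torus d n) tau x (embed n h).

Definition volume (n : nat) : nat := #|{: torus d n}|.

Definition gs_energy_density (h : local_op) : R :=
  limn (fun n => inf [set energy (hamiltonian n h) u / (volume n)%:R
                     | u in [set u | normalized u]]).

Definition translation_invariant (n : nat) (u : hvector R q (torus d n)) : Prop :=
  forall (A : local_op) (x : torus d n), fits n A ->
    expectation u (embed n A) = expectation u (tau x (embed n A)).

(** Distinct [local_op]s can denote the same operator (A and A tensored with the
    identity, or reordered sites), and sums need a common support.  So an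
    identity between local operators is read on all large enough tori; this makes
    [w] well defined on, and linear over, the algebra of local operators. *)
Definition linear_functional (w : local_op -> Cplx R) : Prop :=
  forall (a : Cplx R) (A B D : local_op),
    (\forall n \near \oo, embed n D = a *: embed n A + embed n B) ->
    w D = a * w A + w B.

Definition limit_state (side : nat -> nat)
    (u : forall k, hvector R q (torus d (side k))) (w : local_op -> Cplx R) : Prop :=
  forall A : local_op, expectation (u k) (embed (side k) A) @[k --> \oo] --> w A.

Definition infinite_volume_state (w : local_op -> Cplx R) : Prop :=
  linear_functional w /\
  exists (side : nat -> nat) (u : forall k, hvector R q (torus d (side k))),
    [/\ side k @[k --> \oo] --> \oo, forall k, normalized (u k) & limit_state u w].

Definition infinite_volume_ground_state (h : local_op)
    (w : local_op -> Cplx R) : Prop :=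
  infinite_volume_state w /\
  forall x : Zd d, w (translate x h) = ((gs_energy_density h)%:C : Cplx R).

End Lattice.

(* Main.v *)
(** The only delicate point is that the ground state energies per site of the
    periodic cubes converge along all cubes, so that the limit along the given
    subsequence is the energy density.  On a torus of side [n + 1], keep only the
    terms of the Hamiltonian that do not feel the periodic boundary.  As a bulk
    operator, their sum also acts on every translate of the cube inside a larger
    torus, and there it is bounded below by the energy of the small torus up to a
    boundary term, because tensoring with the identity preserves lower bounds.
    Summing over all translates counts each [h_x] of the large torus equally
    often, so the energy per site of the large torus is at least that of the small
    one minus an error that vanishes with the surface to volume ratio.  A bounded
    sequence with this property converges.

    By translation invariance [w (h_x)] is the limit of the energy per site of the
    low-lying states, which has the same limit as that of the ground states. *)

Require Import Defs.
From HB Require Import structures.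
From mathcomp Require Import all_boot all_order all_algebra.
From mathcomp Require Import complex.
From mathcomp Require Import ring lra zify.
From mathcomp Require Import all_classical all_reals all_analysis.

Set Implicit Arguments.
Unset Strict Implicit.
Unset Printing Implicit Defensive.

Import Order.TTheory GRing.Theory Num.Theory numFieldNormedType.Exports.

Local Open Scope classical_set_scope.
Local Open Scope ring_scope.
Local Open Scope sesquilinear_scope.

Local Notation expectation := Defs.expectation.
Local Notation shift := Defs.shift.

(** * Real and imaginary parts of complex scalars *)

Section ComplexParts.
Variable R : realType.
Implicit Types (x y : Cplx R) (r : R).
Local Notation rc r := ((r%:C)%C : Cplx R).

Lemma Cplx_ReD x y : complex.Re (x + y) = complex.Re x + complex.Re y.
Proof. by case: x; case: y. Qed.

Lemma Cplx_Re_sum (I : Type) (s : seq I) (P : pred I) (F : I -> Cplx R) :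
  complex.Re (\sum_(i <- s | P i) F i) = \sum_(i <- s | P i) complex.Re (F i).
Proof. by apply: (big_morph (@complex.Re R)) => //; apply: Cplx_ReD. Qed.

Lemma Cplx_ReMr r x : complex.Re (rc r * x) = r * complex.Re x.
Proof. by case: x => a b /=; rewrite mul0r subr0. Qed.

Lemma Cplx_RecM r r' : rc r * rc r' = rc (r * r').
Proof. by congr (Complex _ _); rewrite /= ?mulr0 ?mul0r ?subr0 ?addr0. Qed.

Lemma Cplx_leE x y :
  (x <= y) = (complex.Im y == complex.Im x) && (complex.Re x <= complex.Re y).
Proof. by case: x; case: y. Qed.

Lemma Cplx_le_Re x y : x <= y -> complex.Re x <= complex.Re y.
Proof. by rewrite Cplx_leE => /andP[]. Qed.

Lemma Cplx_ge0_Re x : 0 <= x -> x = rc (complex.Re x).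
Proof. by case: x => a b; rewrite Cplx_leE /= => /andP[/eqP -> _]. Qed.

(** Lets the generic conjugation of the sealed field compute on real and imaginary parts. *)
Lemma Cplx_conjE x : x^* = conjc x :> Cplx R.
Proof. by []. Qed.

Lemma Cplx_conj_eq x : x^* = x -> x = rc (complex.Re x).
Proof.
rewrite Cplx_conjE; case: x => a b [/eqP] /=.
by rewrite eq_sym -addr_eq0 -mulr2n mulrn_eq0 /= => /eqP ->.
Qed.

Lemma Cplx_conj_Rec r : (rc r)^* = rc r.
Proof. by rewrite Cplx_conjE /= oppr0. Qed.

Lemma Cplx_normr_Re x : `|complex.Re x| <= complex.Re `|x|.
Proof.
case: x => a b; rewrite [X in _ <= X]/=.
by rewrite -[X in X <= _]sqrtr_sqr ler_wsqrtr // lerDl sqr_ge0.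
Qed.

End ComplexParts.

(** * Expectation values and the variational principle *)

Section Hilbert.
Variables (R : realType) (m : nat).
Implicit Types (u v : 'cV[Cplx R]_m) (A B : 'M[Cplx R]_m) (r : R).
Local Notation rc r := ((r%:C)%C : Cplx R).

Definition sqnorm u : R := complex.Re (inner u u).

Lemma innerE u v : inner u v = \sum_i (u i 0)^* * v i 0.
Proof. by rewrite /inner mxE; apply: eq_bigr => i _; rewrite !mxE. Qed.

Lemma expectationE u A :
  expectation u A = \sum_i \sum_j (u i 0)^* * A i j * u j 0.
Proof.
rewrite /expectation innerE; apply: eq_bigr => i _.
by rewrite mxE mulr_sumr; apply: eq_bigr => j _; rewrite mulrA.
Qed.

Lemma inner_sqnorm u : inner u u = rc (sqnorm u).
Proof.
apply: Cplx_ge0_Re; rewrite innerE sumr_ge0 // => i _.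
by rewrite mulrC -normCK exprn_ge0.
Qed.

Lemma normalized_sqnorm u : normalized u <-> sqnorm u = 1.
Proof.
rewrite /normalized /sqnorm; split=> [-> //|u1].
by rewrite inner_sqnorm /sqnorm u1.
Qed.

Lemma sqnorm_ge0 u : 0 <= sqnorm u.
Proof.
suff: 0 <= inner u u by move/Cplx_le_Re.
by rewrite innerE sumr_ge0 // => i _; rewrite mulrC -normCK exprn_ge0.
Qed.

Lemma sqnorm_eq0 u : sqnorm u = 0 -> u = 0.
Proof.
move=> u0; have /eqP : inner u u = 0 by rewrite inner_sqnorm u0.
rewrite innerE psumr_eq0 => [/allP z|i _]; last first.
  by rewrite mulrC -normCK exprn_ge0.
apply/colP => i; rewrite mxE; apply/eqP.
by have := z i (mem_index_enum i); rewrite mulrC -normCK expf_eq0 /= normr_eq0.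
Qed.

Lemma expectation1 u : expectation u 1%:M = inner u u.
Proof. by rewrite /expectation mul1mx. Qed.

Lemma expectationD u A B :
  expectation u (A + B) = expectation u A + expectation u B.
Proof. by rewrite /expectation /inner mulmxDl mulmxDr mxE. Qed.

Lemma expectationZ a u A : expectation u (a *: A) = a * expectation u A.
Proof. by rewrite /expectation /inner -scalemxAl -scalemxAr mxE. Qed.

Lemma expectation_sum (I : Type) (s : seq I) (P : pred I) u
    (F : I -> 'M[Cplx R]_m) :
  expectation u (\sum_(i <- s | P i) F i) =
  \sum_(i <- s | P i) expectation u (F i).
Proof.
apply: (big_morph (expectation u)); first exact: expectationD.
by rewrite /expectation /inner mul0mx mulmx0 mxE.
Qed.

Lemma energy_sum (I : Type) (s : seq I) (P : pred I) u
    (F : I -> 'M[Cplx R]_m) :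
  energy (\sum_(i <- s | P i) F i) u = \sum_(i <- s | P i) energy (F i) u.
Proof. by rewrite /energy expectation_sum Cplx_Re_sum. Qed.

Lemma energyN A u : energy (- A) u = - energy A u.
Proof.
rewrite /energy -scaleN1r expectationZ mulN1r.
by case: (expectation u A).
Qed.

Lemma energyScol r u A : energy A (rc r *: u) = r ^+ 2 * energy A u.
Proof.
rewrite /energy -Cplx_ReMr expectationE; congr complex.Re.
rewrite expectationE mulr_sumr; apply: eq_bigr => i _.
rewrite mulr_sumr; apply: eq_bigr => j _; rewrite !mxE rmorphM /=.
rewrite [in LHS](_ : (rc r)^* = rc r) ?Cplx_conj_Rec //.
by rewrite expr2 -Cplx_RecM; move: (rc r) => z; ring.
Qed.

Lemma expectation_hermsym A u :
  A \is hermsymmx -> expectation u A = rc (energy A u).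
Proof.
move=> /is_hermitianmxP; rewrite expr0 scale1r => hA.
apply: Cplx_conj_eq; rewrite expectationE rmorph_sum exchange_big /=.
apply: eq_bigr => i _; rewrite rmorph_sum; apply: eq_bigr => j _ /=.
rewrite !rmorphM /= conjCK [in RHS]hA !mxE; ring.
Qed.

(** The entrywise l1 norm, a crude upper bound for the operator norm. Only its independence of the
    torus matters later, not its sharpness. *)
Definition mxnorm1 A : R := \sum_i \sum_j complex.Re `|A i j|.

Lemma energy_bound A u : `|energy A u| <= mxnorm1 A * sqnorm u.
Proof.
apply: le_trans (Cplx_normr_Re _) _.
suff: `|expectation u A| <= (\sum_i \sum_j `|A i j|) * inner u u.
  move/Cplx_le_Re; move/le_trans; apply.
  rewrite inner_sqnorm mulrC Cplx_ReMr mulrC Cplx_Re_sum.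
  by under eq_bigr do rewrite Cplx_Re_sum.
(* The product of two moduli is at most the square of the larger one, which is a single term of
   [inner u u]. *)
have uu i j : `|u i 0| * `|u j 0| <= inner u u.
  have ui k : `|u k 0| ^+ 2 <= inner u u.
    rewrite innerE (bigD1 k) //= [(u k 0)^* * _]mulrC -normCK lerDl.
    by apply: sumr_ge0 => l _; rewrite mulrC -normCK exprn_ge0.
  have [le|/ltW le] := real_leP (normr_real (u i 0)) (normr_real (u j 0)).
    by apply: le_trans (ui j); rewrite expr2 ler_wpM2r.
  by apply: le_trans (ui i); rewrite expr2 ler_wpM2l.
rewrite expectationE mulr_suml (le_trans (ler_norm_sum _ _ _)) // ler_sum // => i _.
rewrite mulr_suml (le_trans (ler_norm_sum _ _ _)) // ler_sum // => j _.
by rewrite !normrM norm_conjC mulrAC mulrC ler_wpM2l.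
Qed.

Lemma mxnorm1_ge0 A : 0 <= mxnorm1 A.
Proof.
apply: sumr_ge0 => i _; apply: sumr_ge0 => j _.
by have /Cplx_le_Re := normr_ge0 (A i j).
Qed.

(** Both sides scale quadratically, which settles nonzero vectors. The homogeneous form is needed
    because the slices of a normalized vector are not normalized. *)
Lemma energy_ge_normalized A r :
  (forall u, normalized u -> r <= energy A u) ->
  forall u, r * sqnorm u <= energy A u.
Proof.
move=> rA u; have [/sqnorm_eq0 ->|u0] := eqVneq (sqnorm u) 0.
  have -> : (0 : 'cV[Cplx R]_m) = rc 0 *: 0 by rewrite scaler0.
  rewrite energyScol expr0n mul0r scaler0 /sqnorm /inner mulmx0 mxE.
  by rewrite mulr0.
have u_gt0 : 0 < sqnorm u by rewrite lt_def u0 sqnorm_ge0.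
set c := (Num.sqrt (sqnorm u))^-1.
have c2 : c ^+ 2 = (sqnorm u)^-1 by rewrite /c exprVn sqr_sqrtr ?sqnorm_ge0.
have : r <= energy A (rc c *: u).
  apply: rA; apply/normalized_sqnorm; rewrite /sqnorm -expectation1.
  by rewrite -/(energy _ _) energyScol /energy expectation1 c2 mulVf.
by rewrite energyScol c2 mulrC ler_pdivlMr.
Qed.

(** Diagonalizing [A] by a unitary makes the energy an average of eigenvalues, weighted by the
    squared moduli of the rotated coordinates. *)
Lemma lowest_eigenvalue_le_energy A E u :
  A \is hermsymmx -> lowest_eigenvalue A E -> normalized u -> E <= energy A u.
Proof.
move=> hA [_ minE]; move: u.
suff H u : E * sqnorm u <= energy A u.
  by move=> u /normalized_sqnorm u1; rewrite -[E]mulr1 -u1; exact: H.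
have /orthomx_spectralP := hermitian_normalmx hA.
set P := spectralmx A; set D := spectral_diag A => AE.
have PU : P \is unitarymx := spectral_unitarymx A.
(* [eigenvalue] refers to row vectors acted on from the right, so the rows of [P] are the
   eigenvectors; they are nonzero because [P] is invertible. *)
have ED j : rc E <= D 0 j.
  apply: minE; apply/eigenvalueP; exists (row j P).
    rewrite [in LHS]AE -!mulmxA -row_mul !mulmxA mulmxV ?unitarymx_unit //.
    rewrite mul1mx; apply/rowP => k; rewrite !mxE (bigD1 j) //= big1 => [|l lj].
      by rewrite !mxE eqxx addr0.
    by rewrite !mxE eq_sym (negbTE lj) mul0r.
  apply/eqP => rP; have : row j (P *m invmx P) = 0 by rewrite row_mul rP mul0mx.
  rewrite mulmxV ?unitarymx_unit // => /rowP/(_ j)/eqP.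
  by rewrite !mxE eqxx oner_eq0.
set v := P *m u.
have uv : inner u u = inner v v.
  rewrite /inner /v trmx_mul map_mxM -!mulmxA [P^t* *m _]mulmxA.
  by rewrite -invmx_unitary // mulVmx ?unitarymx_unit // mul1mx.
have Av : expectation u A = \sum_i D 0 i * ((v i 0)^* * v i 0).
  have -> : expectation u A = inner v (diag_mx D *m v).
    by rewrite /expectation /inner AE invmx_unitary // /v trmx_mul map_mxM -!mulmxA.
  rewrite innerE; apply: eq_bigr => i _.
  by rewrite mul_diag_mx [X in _ * X]mxE mulrCA.
suff /Cplx_le_Re : rc E * inner u u <= expectation u A by rewrite Cplx_ReMr.
rewrite uv Av innerE mulr_sumr; apply: ler_sum => i _.
by rewrite ler_wpM2r // mulrC -normCK exprn_ge0.
Qed.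

End Hilbert.

(** * Operators tensored with the identity *)

Section Embedding.
Variables (R : realType) (q : nat).

Definition pullback (I J : finType) (g : I -> J) (s : config J q) :
  config I q := [ffun i => s (g i)].

Definition agree_off (I J : finType) (g : I -> J) (s t : config J q) : bool :=
  [forall y, (y \notin codom g) ==> (s y == t y)].

(** Extends [embed] to arbitrary site maps, so that compositions of embeddings
    can be formed; meaningful for injective [g]. *)
Definition emb (I J : finType) (g : I -> J) (A : operator R q I) :
  operator R q J :=
  \matrix_(i, j)
    if agree_off g (enum_val i) (enum_val j)
    then A (enum_rank (pullback g (enum_val i)))
           (enum_rank (pullback g (enum_val j)))
    else 0.

Lemma agree_offP (I J : finType) (g : I -> J) (s t : config J q) :
  reflect (forall y, y \notin codom g -> s y = t y) (agree_off g s t).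
Proof.
apply: (iffP forallP) => st y; last by apply/implyP => /st ->.
by move/(implyP (st y)) => /eqP.
Qed.

Lemma embN (I J : finType) (g : I -> J) (A : operator R q I) :
  emb g (- A) = - emb g A.
Proof. by apply/matrixP => i j; rewrite !mxE; case: ifP; rewrite ?oppr0. Qed.

Lemma emb_sum (I J X : finType) (g : I -> J) (P : pred X)
    (F : X -> operator R q I) :
  emb g (\sum_(x | P x) F x) = \sum_(x | P x) emb g (F x).
Proof.
apply/matrixP => i j; rewrite !mxE !summxE; case: ifP => ij.
  by apply: eq_bigr => x _; rewrite mxE ij.
by rewrite big1 // => x _; rewrite mxE ij.
Qed.

Lemma eq_emb (I J : finType) (f g : I -> J) (A : operator R q I) :
  f =1 g -> emb f A = emb g A.
Proof. by move=> /funext ->. Qed.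

Lemma emb1 (I J : finType) (g : I -> J) :
  emb g (1%:M : operator R q I) = 1%:M.
Proof.
apply/matrixP => i j; rewrite !mxE [in LHS](inj_eq enum_rank_inj).
have [->|ij] := eqVneq i j.
  by rewrite eqxx; case: ifPn => // /agree_offP [].
case: ifP => [/agree_offP ag|//]; case: eqP => // /ffunP eg.
case/eqP: ij; apply: enum_val_inj; apply/ffunP => y.
have [/codomP [x ->]|/ag //] := boolP (y \in codom g).
by have := eg x; rewrite !ffunE.
Qed.

Lemma emb_hermsym (I J : finType) (g : I -> J) (A : operator R q I) :
  A \is hermsymmx -> emb g A \is hermsymmx.
Proof.
move=> /is_hermitianmxP; rewrite expr0 scale1r => hA.
apply/is_hermitianmxP; rewrite expr0 scale1r.
apply/matrixP => i j; rewrite !mxE [agree_off _ _ (enum_val i)](_ : _ =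
  agree_off g (enum_val i) (enum_val j)); last first.
  by apply: eq_forallb => y; rewrite eq_sym.
by case: ifP => _; rewrite ?conjC0 // [in LHS]hA !mxE.
Qed.

(** Two configurations agree off the range of [f \o g] exactly when they agree off the range of [f]
    and their pullbacks agree off the range of [g]. Injectivity of [f] keeps the points outside the
    range of [g] outside the composite range. *)
Lemma emb_comp (I J K : finType) (f : J -> K) (g : I -> J)
    (A : operator R q I) :
  injective f -> emb f (emb g A) = emb (f \o g) A.
Proof.
move=> f_inj; apply/matrixP => i j; rewrite !mxE !enum_rankK.
have pb (s : config K q) : pullback g (pullback f s) = pullback (f \o g) s.
  by apply/ffunP => x; rewrite !ffunE.
rewrite !pb; set s := enum_val i; set t := enum_val j.
suff -> : agree_off (f \o g) s t =
  agree_off f s t && agree_off g (pullback f s) (pullback f t).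
  by case: agree_off; case: agree_off.
apply/agree_offP/andP => [st|[/agree_offP sf /agree_offP sg] y yfg].
  split; apply/agree_offP => y yN.
    by apply: st; apply: contra yN => /codomP [x ->]; apply/codomP; exists (g x).
  rewrite !ffunE; apply: st; apply: contra yN => /codomP [x /f_inj ->].
  exact: codom_f.
have [/codomP [x yx]|/sf //] := boolP (y \in codom f).
have /sg : x \notin codom g.
  apply: contra yfg => /codomP [z xz]; apply/codomP; exists z.
  by rewrite yx xz.
by rewrite !ffunE yx.
Qed.

(** * Slicing a vector along the complement of the embedded sites *)

Section Slices.
Variables (I J : finType) (g : I -> J) (g_inj : injective g).
Variable c : config J q.

Definition glue (r : config J q) (s : config I q) : config J q :=
  [ffun y => if [pick x | g x == y] is Some x then s x else r y].

(** Normal form modulo the values on the range of [g], which are reset to the reference [c]. Its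
    fixed points label the basis of the complementary tensor factor. *)
Definition outside (s : config J q) : config J q :=
  [ffun y => if y \in codom g then c y else s y].

(** The component of [u] along the complementary basis vector labelled by [r]. *)
Definition slice (u : hvector R q J) (r : config J q) : hvector R q I :=
  \col_i u (enum_rank (glue r (enum_val i))) 0.

Lemma glueE r s x : glue r s (g x) = s x.
Proof.
rewrite ffunE; case: pickP => [z /eqP /g_inj -> //|/(_ x)].
by rewrite eqxx.
Qed.

Lemma glue_out r s y : y \notin codom g -> glue r s y = r y.
Proof.
move=> yg; rewrite ffunE; case: pickP => // z /eqP zy.
by rewrite -zy codom_f in yg.
Qed.

Lemma pullback_glue r s : pullback g (glue r s) = s.
Proof. by apply/ffunP => x; rewrite ffunE glueE. Qed.

Lemma glue_pullback s : glue (outside s) (pullback g s) = s.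
Proof.
apply/ffunP => y; have [/codomP [x ->]|yg] := boolP (y \in codom g).
  by rewrite glueE ffunE.
by rewrite glue_out // ffunE (negbTE yg).
Qed.

Lemma outside_glue r s : outside r = r -> outside (glue r s) = r.
Proof.
move=> rr; apply/ffunP => y; rewrite ffunE; case: ifPn => yg.
  by rewrite -[in RHS]rr ffunE yg.
by rewrite glue_out.
Qed.

Lemma agree_off_outside s t : agree_off g s t = (outside s == outside t).
Proof.
apply/agree_offP/eqP => [st|/ffunP st y yg].
  by apply/ffunP => y; rewrite !ffunE; case: ifPn => // /st ->.
by have := st y; rewrite !ffunE (negbTE yg).
Qed.

Lemma sum_config (F : config J q -> Cplx R) :
  \sum_s F s = \sum_(r | outside r == r) \sum_(s : config I q) F (glue r s).
Proof.
have oo s : outside (outside s) == outside s.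
  by apply/eqP/ffunP => y; rewrite !ffunE; case: (y \in codom g).
rewrite (partition_big outside (fun r => outside r == r)) //=.
apply: eq_bigr => r /eqP rr; rewrite (reindex (glue r)) /=; last first.
  exists (pullback g) => s; first by rewrite pullback_glue.
  by rewrite inE => /eqP <-; apply: glue_pullback.
by apply: eq_bigl => s; rewrite outside_glue ?eqxx.
Qed.

Lemma sum_op (F : 'I_#|config J q| -> Cplx R) :
  \sum_i F i = \sum_s F (enum_rank s).
Proof. by rewrite (reindex _ (onW_bij _ (@enum_rank_bij _))). Qed.

(** In the complementary basis the embedded operator is block diagonal, with every block equal to
    [A]; the cross terms between different labels vanish. *)
Lemma expectation_emb u (A : operator R q I) :
  expectation u (emb g A) =
  \sum_(r | outside r == r) expectation (slice u r) A.
Proof.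
rewrite expectationE sum_op sum_config; apply: eq_bigr => r /eqP rr.
rewrite expectationE (reindex _ (onW_bij _ (@enum_rank_bij _))) /=.
apply: eq_bigr => s _.
rewrite sum_op sum_config (bigD1 r) /=; last by rewrite rr.
rewrite [X in _ + X]big1 ?addr0 => [|r' /andP[/eqP rr' r'r]]; last first.
  rewrite big1 // => t _; rewrite !mxE !enum_rankK agree_off_outside.
  by rewrite !outside_glue // eq_sym (negbTE r'r) mulr0 mul0r.
rewrite [in RHS](reindex _ (onW_bij _ (@enum_rank_bij _))) /=.
apply: eq_bigr => t _; rewrite !mxE !enum_rankK agree_off_outside.
by rewrite !outside_glue // eqxx !pullback_glue.
Qed.

Lemma sqnorm_slices u :
  sqnorm u = \sum_(r | outside r == r) sqnorm (slice u r).
Proof.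
rewrite /sqnorm -expectation1 -(emb1 g) expectation_emb Cplx_Re_sum.
by under eq_bigr do rewrite expectation1.
Qed.

End Slices.

Hypothesis q_gt0 : (0 < q)%N.

(** The bound holds on every slice, and energies and squared norms both add up over slices. *)
Lemma energy_emb_ge (I J : finType) (g : I -> J) (A : operator R q I) (r : R) :
  injective g -> (forall v, r * sqnorm v <= energy A v) ->
  forall u, r * sqnorm u <= energy (emb g A) u.
Proof.
move=> g_inj rA u; pose c : config J q := [ffun=> Ordinal q_gt0].
rewrite (sqnorm_slices g_inj c) /energy (expectation_emb g_inj c) Cplx_Re_sum.
by rewrite mulr_sumr ler_sum // => s _; apply: rA.
Qed.

(** The constant does not depend on [J], so one bound serves every term of the Hamiltonian on every
    torus. The upper bound is the lower bound for [- A]. *)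
Lemma energy_emb_bound (I J : finType) (g : I -> J) (A : operator R q I) u :
  injective g -> `|energy (emb g A) u| <= mxnorm1 A * sqnorm u.
Proof.
move=> g_inj; have low B : - mxnorm1 B * sqnorm u <= energy (emb g B) u.
  apply: energy_emb_ge => // v; have := energy_bound B v.
  by rewrite mulNr ler_norml => /andP[].
rewrite ler_norml -mulNr low /= -lerN2 -energyN -embN.
rewrite -mulNr; apply: le_trans (low (- A)).
rewrite (_ : mxnorm1 (- A) = mxnorm1 A) //; rewrite /mxnorm1.
by apply: eq_bigr => i _; apply: eq_bigr => j _; rewrite mxE normrN.
Qed.

End Embedding.

(** * Translations, cubes and their bulk sites *)

Section Lattice.
Variables (R : realType) (d q : nat).
Local Notation site n A := (@torus_site R d q n A).
Implicit Types (A h : local_op R d q) (n m r : nat).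

Lemma embedE n A : embed n A = emb (site n A) (lop_mx A).
Proof. by []. Qed.

Lemma tau_emb (I : finType) n (x : torus d n) (g : I -> torus d n)
    (A : operator R q I) :
  tau x (emb g A) = emb (fun i => g i + x) A.
Proof.
apply/matrixP => i j; rewrite !mxE !enum_rankK.
have pb (s : config (torus d n) q) :
    pullback g (shift x s) = pullback (fun i => g i + x) s.
  by apply/ffunP => y; rewrite !ffunE.
rewrite !pb; set s := enum_val i; set t := enum_val j.
suff -> : agree_off g (shift x s) (shift x t) =
  agree_off (fun i => g i + x) s t by [].
have yx y : (y \in codom (fun i => g i + x)) = (y - x \in codom g).
  apply/codomP/codomP => -[i0 e]; exists i0; last by rewrite -e subrK.
  by rewrite e addrK.
apply/agree_offP/agree_offP => st y yg.
  by have := st (y - x); rewrite !ffunE subrK -yx; apply.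
by rewrite !ffunE st // yx addrK.
Qed.

Lemma hamiltonianE n h :
  hamiltonian n h =
  \sum_(x : torus d n) emb (fun i => site n h i + x) (lop_mx h).
Proof. by apply: eq_bigr => x _; rewrite embedE tau_emb. Qed.

Lemma hamiltonian_hermsym n h :
  self_adjoint h -> hamiltonian n h \is hermsymmx.
Proof.
move=> hsa; rewrite hamiltonianE; apply/is_hermitianmxP.
rewrite expr0 scale1r raddf_sum raddf_sum /=; apply: eq_bigr => x _.
have /is_hermitianmxP := emb_hermsym (fun i => site n h i + x) hsa.
by rewrite expr0 scale1r.
Qed.

Lemma to_torusD n (y z : Zd d) :
  to_torus n (y + z) = to_torus n y + to_torus n z.
Proof.
apply/rowP => c; rewrite !mxE; apply/val_inj => /=.
rewrite !modnDm; apply/eqP; rewrite -eqz_nat -!modz_nat !PoszD.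
by rewrite !gez0_abs ?modz_ge0 // modzDm modz_mod.
Qed.

Lemma embed_translate n (z : Zd d) A :
  embed n (translate z A) = tau (to_torus n z) (embed n A).
Proof.
by rewrite !embedE tau_emb; apply: eq_emb => i; rewrite -to_torusD.
Qed.

(** A displacement that stays within [[0, l)] does not wrap around, so modular addition is integer
    addition. *)
Lemma modn_offset (l k : nat) (z : int) :
  0 <= k%:Z + z < l%:Z ->
  ((k + `|(z %% l)%Z|) %% l)%N = absz (k%:Z + z).
Proof.
move=> /andP[kz0 kzl]; have l_gt0 : (0 < l)%N by lia.
have l0 : l%:Z != 0 by lia.
apply/eqP; rewrite -eqz_nat -modz_nat PoszD !gez0_abs ?modz_ge0 //.
by rewrite modzDmr modz_small ?kz0.
Qed.

Definition radius A : nat :=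
  (\max_i \max_c `|lop_site A i ord0 c|)%N.

Lemma radiusP A i c : (`|lop_site A i ord0 c| <= radius A)%N.
Proof.
rewrite /radius; apply: leq_trans (leq_bigmax i).
exact: (leq_bigmax c).
Qed.

(** Coordinates of two sites of [A] differ by at most twice the radius, hence by less than the side
    [n.+1], so congruent coordinates are equal. *)
Lemma fits_large n A : ((radius A).*2 <= n)%N -> fits n A.
Proof.
move=> rn i j /rowP ij; apply: (@lop_inj _ _ _ A); apply/rowP => c.
have := congr1 val (ij c); rewrite !mxE /= => e.
have := radiusP i c; have := radiusP j c.
move: (lop_site A i ord0 c) (lop_site A j ord0 c) e => y z e zr yr.
have /eqP : (y %% n.+1)%Z = (z %% n.+1)%Z.
  move/eqP: e; rewrite -eqz_nat -!modz_nat !gez0_abs ?modz_ge0 //.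
  by rewrite !modz_mod => /eqP.
rewrite eqz_mod_dvd => /dvdzP [k]; case: (eqVneq k 0) => [->|k0]; first by lia.
move=> e2; exfalso; have : (n.+1 <= `|y - z|)%N.
  by rewrite e2 abszM leq_pmull // absz_gt0.
lia.
Qed.

(** The cube [(Z/(n+1))^d] placed in the corner of the larger [(Z/(m+1))^d],
    with its periodic boundary cut open. *)
Definition corner n m (x : torus d n) : torus d m := \row_c inZp (x ord0 c).

Lemma corner_inj n m : (n <= m)%N -> injective (@corner n m).
Proof.
move=> nm x y /rowP xy; apply/rowP => c; apply/val_inj.
have := congr1 val (xy c); rewrite !mxE /= !modn_small //.
  exact: leq_trans (ltn_ord _) _.
exact: leq_trans (ltn_ord _) _.
Qed.

(** The positions from which a displacement of size at most [r] in each coordinate cannot cross the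
    periodic boundary. *)
Definition bulk r n : pred (torus d n) :=
  fun x => [forall c, (r <= x ord0 c)%N && (x ord0 c + r < n.+1)%N].

(** No coordinate wraps around on either torus, so both sides are the same integer addition. *)
Lemma corner_bulk n m r (x : torus d n) (z : Zd d) : (n <= m)%N ->
  (forall c, (`|z ord0 c| <= r)%N) -> bulk r x ->
  corner m (to_torus n z + x) = to_torus m z + corner m x.
Proof.
move=> nm zr /forallP xr; apply/rowP => c; apply/val_inj.
have := zr c; have /andP := xr c; rewrite !mxE /=.
move: (x ord0 c) (ltn_ord (x ord0 c)) (z ord0 c) => k kn {}z [rk kr] {}zr.
rewrite modnDm modnDml ![(_ + nat_of_ord k)%N]addnC !modn_offset; try by lia.
by rewrite modn_small //; lia.
Qed.

Lemma volumeE n : volume d n = (n.+1 ^ d)%N.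
Proof. by rewrite /volume card_mx card_ord mul1n. Qed.

Lemma volume_gt0 n : (0 < volume d n)%N.
Proof. by rewrite volumeE expn_gt0. Qed.

Lemma card_bulk r n : ((n.+1 - r.*2) ^ d <= #|@bulk r n|)%N.
Proof.
(* For small cubes the truncated subtraction gives 0. Its power is 0 unless [d] is 0, when it is 1
   and the only site is vacuously a bulk site. *)
have [rn|rn] := leqP n.+1 r.*2.
  rewrite (eqP (_ : n.+1 - r.*2 == 0))%N; last by lia.
  case: (posnP d) => [d0|d0]; last by rewrite exp0n.
  rewrite [X in (_ ^ X)%N]d0 expn0; apply/card_gt0P; exists 0; apply/forallP => c.
  by have := ltn_ord c; lia.
pose f (s : {ffun 'I_d -> 'I_(n.+1 - r.*2)}) : torus d n :=
  \row_c inord (r + s c).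
have fE s c : f s ord0 c = (r + s c)%N :> nat.
  by rewrite mxE inordK //; have := ltn_ord (s c); lia.
have f_inj : injective f.
  move=> s t st; apply/ffunP => c; apply/val_inj.
  by apply: (@addnI r); rewrite -!fE st.
have -> : ((n.+1 - r.*2) ^ d)%N = #|codom f|.
  by rewrite card_codom // card_ffun !card_ord.
apply/subset_leq_card/fintype.subsetP => _ /codomP [s ->].
apply/forallP => c; rewrite !fE leq_addr /=.
by case: (s c) => k /= ks; lia.
Qed.

End Lattice.

(** * Convergence of the ground state energies per site *)

(** The limit is the supremum of the [e n - delta n]: a nearly optimal index bounds all later [e m]
    from below, and [e n] exceeds the supremum by at most [delta n]. *)
Lemma cvg_almost_nondecreasing (R : realType) (e delta : nat -> R) (C : R) n0 :
  delta n @[n --> \oo] --> (0 : R) ->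
  (forall n, (n0 <= n)%N -> e n <= C) ->
  (forall n m, (n0 <= n <= m)%N -> e n - delta n <= e m) ->
  cvgn e.
Proof.
move=> delta0 eC mono.
pose S := [set x | exists2 n, (n0 <= n)%N & x = e n - delta n]%classic.
have S0 : S !=set0 by exists (e n0 - delta n0), n0.
have ubS : has_ubound S.
  exists C => _ [n n0n ->].
  by apply: (@le_trans _ _ (e n)); [apply: mono; rewrite n0n /= | apply: eC].
apply/cvg_ex; exists (sup S); apply/cvgrPdist_le => eps eps_gt0.
have [_ [n1 n01 ->] e1] := sup_adherent eps_gt0 (conj S0 ubS).
have /cvgrPdist_le/(_ _ eps_gt0) delta_eps := delta0.
near=> n; have n0n : (n0 <= n)%N by near: n; apply: nbhs_infty_ge.
have n1n : (n1 <= n)%N by near: n; apply: nbhs_infty_ge.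
have : `|0 - delta n| <= eps by near: n.
rewrite sub0r normrN ler_norml => /andP[_ dn].
have : e n1 - delta n1 <= e n by apply: mono; rewrite n01.
have : e n - delta n <= sup S by apply: ub_le_sup => //; exists n.
rewrite ler_norml; lra.
Unshelve. all: by end_near. Qed.

Section EnergyDensity.
Variables (R : realType) (d q : nat).
Local Notation site n A := (@torus_site R d q n A).
Variables (h : local_op R d q) (q_gt0 : (0 < q)%N).

Definition density n : R :=
  inf [set energy (hamiltonian n h) u / (volume d n)%:R
      | u in [set u | normalized u]]%classic.

Let N n : R := (volume d n)%:R.
Let C : R := mxnorm1 (lop_mx h).
Let N_gt0 n : 0 < N n. Proof. by rewrite ltr0n volume_gt0. Qed.

Lemma sum_torus_const n (P : pred (torus d n)) (x : R) :
  \sum_(a | P a) x = #|P|%:R * x.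
Proof. by rewrite sumr_const mulr_natl. Qed.

Lemma site_shift_inj n (x : torus d n) :
  fits n h -> injective (fun i => site n h i + x).
Proof. by move=> fit i j /addIr /fit. Qed.

Lemma hamiltonian_bound n u : fits n h ->
  `|energy (hamiltonian n h) u| <= N n * (C * sqnorm u).
Proof.
move=> fit; rewrite hamiltonianE energy_sum /N /volume -sum_torus_const.
apply: le_trans (ler_norm_sum _ _ _) _; apply: ler_sum => x _.
exact/energy_emb_bound/site_shift_inj.
Qed.

Lemma energy_density_ge n u : fits n h -> normalized u ->
  - C <= energy (hamiltonian n h) u / N n.
Proof.
move=> fit /normalized_sqnorm u1; rewrite ler_pdivlMr // mulNr mulrC.
by have := hamiltonian_bound u fit; rewrite u1 mulr1 ler_norml => /andP[].
Qed.

(** [inf] is a genuine lower bound only for a set bounded below; [- C] provides that bound. *)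
Lemma density_le n u : fits n h -> normalized u ->
  density n <= energy (hamiltonian n h) u / N n.
Proof.
move=> fit u1; apply: ge_inf; last by exists u.
by exists (- C) => _ [v v1 <-]; apply: energy_density_ge.
Qed.

(** Makes the set under the infimum nonempty, so that [inf] does not take its default value. *)
Lemma normalized_exists n : exists u : hvector R q (torus d n), normalized u.
Proof.
have c : config (torus d n) q := [ffun=> Ordinal q_gt0].
exists (delta_mx (enum_rank c) 0); rewrite /normalized innerE.
rewrite (bigD1 (enum_rank c)) //= big1 => [|i /negPf ic].
  by rewrite !mxE !eqxx /= mulr1 addr0 conjC1.
by rewrite !mxE ic /= mulr0.
Qed.

Lemma le_density n x :
  (forall u : hvector R q (torus d n), normalized u ->
    x <= energy (hamiltonian n h) u / N n) -> x <= density n.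
Proof.
move=> xu; apply: lb_le_inf => [|_ [u u1 <-]]; last exact: xu.
have [u u1] := normalized_exists n.
by exists (energy (hamiltonian n h) u / N n), u.
Qed.

Lemma density_le_bound n : fits n h -> density n <= C.
Proof.
move=> fit; have [u u1] := normalized_exists n.
apply: le_trans (density_le fit u1) _; rewrite ler_pdivrMr // mulrC.
have := hamiltonian_bound u fit.
by rewrite (normalized_sqnorm u).1 // mulr1 ler_norml => /andP[].
Qed.

Lemma energy_ge_density n : fits n h ->
  forall u, density n * N n * sqnorm u <= energy (hamiltonian n h) u.
Proof.
move=> fit; apply: energy_ge_normalized => u u1.
by rewrite -ler_pdivlMr //; apply: density_le.
Qed.

Local Notation B n := (@bulk d (radius h) n).

Definition bulk_ratio n : R := #|B n|%:R / (volume d n)%:R.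

Lemma bulk_ratio_le1 n : bulk_ratio n <= 1.
Proof. by rewrite /bulk_ratio ler_pdivrMr ?N_gt0 // mul1r ler_nat max_card. Qed.

(** Those terms of the Hamiltonian of the small torus that do not feel its
    periodic boundary. *)
Definition bulk_hamiltonian n : operator R q (torus d n) :=
  \sum_(x | B n x) emb (fun i => site n h i + x) (lop_mx h).

(** Dropping the terms outside the bulk costs at most [C] for each of the [N n * (1 - bulk_ratio n)]
    of them. *)
Lemma bulk_hamiltonian_ge n u : fits n h ->
  N n * (density n - C * (1 - bulk_ratio n)) * sqnorm u
    <= energy (bulk_hamiltonian n) u.
Proof.
move=> fit; have := energy_ge_density fit u.
rewrite hamiltonianE (bigID (B n)) /= -/(bulk_hamiltonian n).
have -> (X Y : operator R q (torus d n)) :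
    energy (X + Y) u = energy X u + energy Y u.
  by rewrite /energy expectationD Cplx_ReD.
set rest := energy (\sum_(x | ~~ _) _) u => H.
have : rest <= #|predC (B n)|%:R * (C * sqnorm u).
  rewrite /rest energy_sum -sum_torus_const; apply: ler_sum => x _.
  apply: le_trans (ler_norm _) _.
  exact/energy_emb_bound/site_shift_inj.
have -> : #|predC (B n)|%:R = N n * (1 - bulk_ratio n).
  rewrite mulrBr mulr1 /bulk_ratio mulrCA mulfV ?mulr1 ?gt_eqF //.
  by rewrite /N /volume -(cardC (B n)) natrD addrAC subrr add0r.
move: H; set X := energy _ _; set b := bulk_ratio n; set D := density n.
by move=> H1 H2; nra.
Qed.

(** Summing a translate of the bulk Hamiltonian of the small torus over all its
    positions in the large one counts every [h_x] once per bulk site. *)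
Lemma sum_bulk_energy n m u : (n <= m)%N ->
  \sum_a energy (emb (fun x => corner m x + a) (bulk_hamiltonian n)) u
    = #|B n|%:R * energy (hamiltonian m h) u.
Proof.
move=> nm.
under eq_bigr => a _ do rewrite emb_sum energy_sum.
rewrite exchange_big -sum_torus_const; apply: eq_bigr => x Bx.
(* For a fixed bulk site, adding [corner m x] permutes the positions [a], so the inner sum is the
   whole energy of the large torus. *)
rewrite hamiltonianE energy_sum [RHS](reindex_inj (addrI (corner m x))) /=.
apply: eq_bigr => a _; rewrite emb_comp; last first.
  by move=> y z /addIr; apply: corner_inj.
congr (energy _ u); apply: eq_emb => i /=.
rewrite (corner_bulk nm _ Bx) ?addrA // => c; exact: radiusP.
Qed.

(** One [C * (1 - bulk_ratio n)] pays for the dropped boundary terms. The other pays for replacing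
    [bulk_ratio n * E] by [E], using [- C <= E], where [E] is the energy per site on the large
    torus. *)
Lemma density_almost_nondecreasing n m : fits n h -> fits m h -> (n <= m)%N ->
  density n - 2 * C * (1 - bulk_ratio n) <= density m.
Proof.
move=> fitn fitm nm; apply: le_density => u u1.
have E_ge := energy_density_ge fitm u1.
have : N m * (N n * (density n - C * (1 - bulk_ratio n)))
    <= #|B n|%:R * energy (hamiltonian m h) u.
  rewrite -(sum_bulk_energy u nm) {1}/N -sum_torus_const.
  apply: ler_sum => a _; rewrite -[leLHS]mulr1.
  rewrite -[X in _ * X <= _]((normalized_sqnorm u).1 u1).
  apply: energy_emb_ge => //; first by move=> y z /addIr; apply: corner_inj.
  by move=> v; apply: bulk_hamiltonian_ge.
have -> : #|B n|%:R = N n * bulk_ratio n.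
  by rewrite mulrC /bulk_ratio divfK // gt_eqF ?N_gt0.
move: E_ge; set E := _ / N m => E_ge.
have -> : energy (hamiltonian m h) u = N m * E.
  by rewrite mulrC /E divfK // gt_eqF.
have C_ge0 : 0 <= C := mxnorm1_ge0 _.
move: E_ge (bulk_ratio_le1 n) C_ge0; move: E (bulk_ratio n) C => e b c e_ge b1 c0.
rewrite mulrCA -mulrA ler_pM2l // [leRHS]mulrCA ler_pM2l // => H.
have b0 : 0 <= 1 - b by rewrite subr_ge0.
have ec0 : 0 <= e + c by rewrite -lerBlDr sub0r.
by have := mulr_ge0 b0 ec0; nra.
Qed.

(** The ratio is squeezed between 1 and the fraction of the volume taken by a cube whose side is
    shorter by twice the radius. *)
Lemma bulk_ratio_cvg : (0 < d)%N -> bulk_ratio n @[n --> \oo] --> (1 : R).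
Proof.
move=> d_gt0.
have low : (1 - (radius h).*2%:R * n.+1%:R^-1) ^+ d @[n --> \oo] --> (1 : R).
  have : 1 - (radius h).*2%:R * n.+1%:R^-1 @[n --> \oo] -->
      (1 - (radius h).*2%:R * 0 : R).
    apply: cvgB; first exact: cvg_cst.
    by apply: cvgM; [exact: cvg_cst | exact: cvg_harmonic].
  rewrite mulr0 subr0 => /(cvg_comp _ (fun x => x ^+ d)) low.
  by have := low _ (@exprn_continuous _ d 1); rewrite expr1n.
apply: (squeeze_cvgr _ low (cvg_cst _)).
near=> n; rewrite bulk_ratio_le1 andbT /bulk_ratio ler_pdivlMr ?N_gt0 // volumeE natrX.
(* From here on the truncated subtraction in [card_bulk] is a true difference. *)
have rn : ((radius h).*2 <= n.+1)%N.
  by near: n; exists (radius h).*2 => // k /= /leqW.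
rewrite -exprMn mulrBl mul1r mulfVK ?pnatr_eq0 // -natrB // -natrX ler_nat.
exact: card_bulk.
Unshelve. all: by end_near. Qed.

Lemma density_cvg : (0 < d)%N -> cvgn density.
Proof.
move=> d_gt0.
apply: (@cvg_almost_nondecreasing _ _
  (fun n => 2 * C * (1 - bulk_ratio n)) C (radius h).*2).
- have : 2 * C * (1 - bulk_ratio n) @[n --> \oo] --> 2 * C * (1 - 1).
    apply: cvgM; first exact: cvg_cst.
    by apply: cvgB; [exact: cvg_cst | exact: bulk_ratio_cvg].
  by rewrite subrr mulr0.
- by move=> n rn; apply/density_le_bound/fits_large.
- move=> n m /andP[rn nm]; apply: density_almost_nondecreasing => //.
    exact: fits_large.
  exact/fits_large/(leq_trans rn).
Qed.

End EnergyDensity.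

(** * Finite volume identities and passage to the limit *)

Section Limit.
Variables (R : realType) (d q : nat).
Implicit Types (h : local_op R d q).
Local Notation rc r := ((r%:C)%C : Cplx R).

Lemma cvg_real_complex (r : nat -> R) (l : R) :
  r k @[k --> \oo] --> l -> rc (r k) @[k --> \oo] --> rc l.
Proof.
move=> rl; apply/cvgrPdist_lt => e e_gt0.
(* The radius of a ball is here a complex number; being positive it is real, which reduces the claim
   to real radii. *)
have e0 : 0 < complex.Re e.
  by move: e_gt0; rewrite lt_def Cplx_leE; case: e => a b /=; rewrite lt_def
    eq_complex /= => /andP[ne /andP[/eqP b0 ->]]; rewrite b0 eqxx andbT in ne *;
    rewrite ne.
have eE : e = rc (complex.Re e) by apply: Cplx_ge0_Re; apply: ltW.
move/cvgrPdist_lt: rl => /(_ _ e0); apply: filterS => k rk.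
rewrite eE (_ : rc l - rc (r k) = rc (l - r k)); last first.
  by congr Complex; rewrite /= oppr0 addr0.
have -> : `|rc (l - r k)| = rc `|l - r k|.
  by congr Complex; rewrite /= expr0n /= addr0 sqrtr_sqr.
by rewrite ltcR.
Qed.

(** The torus has a site, so with [q = 0] there is no configuration and every inner product is an
    empty sum. *)
Lemma normalized_q_gt0 n (u : hvector R q (torus d n)) :
  normalized u -> (0 < q)%N.
Proof.
rewrite lt0n => u1; apply/eqP => q0; have /eqP := u1.
rewrite innerE big1 ?[0 == 1]eq_sym ?oner_eq0 // => i _; exfalso.
by case: ((enum_val i : config (torus d n) q) 0) => k; rewrite [X in (_ < X)%N]q0.
Qed.

Lemma ground_state_density n h E u : self_adjoint h -> fits n h ->
  ground_state (hamiltonian n h) E u -> E / (volume d n)%:R = density h n.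
Proof.
move=> hsa fit [lowE u1 Hu]; have q_gt0 := normalized_q_gt0 u1.
have EE : energy (hamiltonian n h) u = E.
  rewrite /energy /expectation Hu /inner -scalemxAr mxE -/(inner u u) u1.
  by rewrite mulr1.
apply/le_anti/andP; split; last by rewrite -EE; apply: density_le.
apply: le_density => // v v1; rewrite ler_pM2r ?invr_gt0 ?ltr0n ?volume_gt0 //.
exact: lowest_eigenvalue_le_energy (hamiltonian_hermsym n hsa) lowE v1.
Qed.

(** All terms of the Hamiltonian have the same expectation, so each carries the total energy divided
    by the volume. *)
Lemma translation_invariant_expectation n h u z :
  self_adjoint h -> fits n h -> translation_invariant u ->
  expectation u (embed n (translate z h)) =
  rc (energy (hamiltonian n h) u / (volume d n)%:R).
Proof.
move=> hsa fit ti; rewrite embed_translate -ti //.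
have hE : expectation u (embed n h) = rc (energy (embed n h) u).
  exact/expectation_hermsym/(@emb_hermsym _ _ _ _ (@torus_site _ _ _ n h)).
rewrite hE; congr Complex; rewrite /hamiltonian energy_sum.
under eq_bigr => x _ do rewrite /energy -ti //.
rewrite sumr_const -/(volume d n) -[X in X / _]mulr_natr mulfK //.
by rewrite pnatr_eq0 -lt0n volume_gt0.
Qed.

(** The operator identity holds on all large tori, hence eventually along [side], and passes to the
    limit. *)
Lemma limit_state_linear (side : nat -> nat)
    (u : forall k, hvector R q (torus d (side k))) (w : local_op R d q -> Cplx R) :
  side k @[k --> \oo] --> \oo -> limit_state u w -> linear_functional w.
Proof.
move=> hside uw a A B D DAB.
have lim2 : expectation (u k) (embed (side k) D) @[k --> \oo] -->
    a * w A + w B.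
  have : a * expectation (u k) (embed (side k) A) +
      expectation (u k) (embed (side k) B) @[k --> \oo] --> a * w A + w B.
    by apply: cvgD; [apply: cvgM; [exact: cvg_cst | exact: uw] | exact: uw].
  apply: cvg_trans; apply: near_eq_cvg.
  have : \forall k \near \oo, embed (side k) D =
      a *: embed (side k) A + embed (side k) B by exact: hside DAB.
  by apply: filterS => k ->; rewrite expectationD expectationZ.
exact: (cvg_unique (@norm_hausdorff (Cplx R) (Cplx R)) (uw D) lim2).
Qed.

End Limit.

Theorem theorem8 (R : realType) (d q : nat) (hd : (0 < d)%N)
    (h : local_op R d q) (hsa : self_adjoint h)
    (side : nat -> nat) (hside : side k @[k --> \oo] --> \oo)
    (E0 : nat -> R)
    (Phi0 : forall k, hvector R q (torus d (side k)))
    (hPhi0 : forall k, ground_state (hamiltonian (side k) h) (E0 k) (Phi0 k))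
    (Phi : forall k, hvector R q (torus d (side k)))
    (hnorm : forall k, normalized (Phi k))
    (horth : forall k, inner (Phi0 k) (Phi k) = 0)
    (hlow : (energy (hamiltonian (side k) h) (Phi k) - E0 k)
              / (volume d (side k))%:R @[k --> \oo] --> (0 : R))
    (hti : forall k, translation_invariant (Phi k))
    (s : nat -> nat) (hs : {homo s : i j / (i < j)%N})
    (w : local_op R d q -> Cplx R)
    (hw : limit_state (fun j => Phi (s j)) w) :
  infinite_volume_ground_state h w.
Proof.
have sk k : (k <= s k)%N.
  by elim: k => // k /leq_ltn_trans; apply; apply: hs.
have s_infty : s k @[k --> \oo] --> \oo.
  apply/cvgnyPge => K; near=> k; apply: leq_trans (sk k).
  by near: k; apply: nbhs_infty_ge.
have side_infty : side (s k) @[k --> \oo] --> \oo by exact: (cvg_comp _ _ s_infty hside).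
have lin := limit_state_linear side_infty hw.
split.
  split=> //; exists (side \o s), (fun j => Phi (s j)); split=> // k.
  exact: hnorm.
move=> x; have q_gt0 := normalized_q_gt0 (hnorm 0%N).
have dens : density h (side k) @[k --> \oo] --> gs_energy_density h.
  have dens0 : density h n @[n --> \oo] --> gs_energy_density h.
    exact: density_cvg.
  exact: (cvg_comp side (density h) hside dens0).
have fit : \forall k \near \oo, fits (side k) h.
  move/cvgnyPge: hside => /(_ (radius h).*2); apply: filterS => k.
  exact: fits_large.
have en : energy (hamiltonian (side k) h) (Phi k) / (volume d (side k))%:R
    @[k --> \oo] --> gs_energy_density h.
  (* The vanishing excess plus the ground state energy per site. The latter equals [density] once
     [h] fits, so the two sequences agree only eventually. *)
  have : (energy (hamiltonian (side k) h) (Phi k) - E0 k)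
      / (volume d (side k))%:R + density h (side k) @[k --> \oo]
      --> gs_energy_density h.
    by rewrite -[gs_energy_density h]add0r; apply: cvgD.
  apply: cvg_trans.
  apply: near_eq_cvg; move: fit; apply: filterS => k fk /=.
  by rewrite -(ground_state_density hsa fk (hPhi0 k)) -mulrDl subrK.
have lim2 : expectation (Phi (s k)) (embed (side (s k)) (translate x h))
    @[k --> \oo] --> ((gs_energy_density h)%:C%C : Cplx R).
  apply: (cvg_comp s (fun k => expectation (Phi k) (embed (side k) (translate x h))) s_infty).
  have := cvg_real_complex en; apply: cvg_trans.
  apply: near_eq_cvg; move: fit; apply: filterS => k fk /=.
  by rewrite (translation_invariant_expectation _ hsa fk (hti k)).
(* [translate x h] is itself a local operator, so [hw] gives a second limit of the same sequence. *)
exact: (cvg_unique (@norm_hausdorff (Cplx R) (Cplx R)) (hw _) lim2).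
Unshelve. all: by end_near. Qed.
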